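(* Let $(A,\succ,\prec,\ast)$ be a noncommutative pre-Poisson algebra. (i) Define $x\cdot y=x\succ y+x\prec y$ and $\{x,y\}=x\ast y-y\ast x$ for all $x,y\in A$. Then $(A,\cdot,\{-,-\})$ is a noncommutative Poisson algebra, called the sub-adjacent noncommutative Poisson algebra and denoted by $A^c$. (ii) If the noncommutative pre-Poisson algebra $(A,\succ,\prec,\ast)$ is coherent, then $A^c$ is also coherent. (iii) $(A;L_\succ,R_\prec,L)$ is a representation of the noncommutative Poisson algebra $A^c$, where $L_{\succ x}(y)=x\succ y$, $R_{\prec x}(y)=y\prec x$ and $L_xy=x\ast y$ for all $x,y\in A$.
   Context: All vector spaces are finite dimensional over an algebraically closed field of characteristic $0$. A dendriform algebra $(A,\succ,\prec)$: bilinear operations with $(x\prec y)\prec z=x\prec(y\succ z+y\prec z)$, $(x\succ y)\prec z=x\succ(y\prec z)$, $x\succ(y\succ z)=(x\succ y+x\prec y)\succ z$. A pre-Lie algebra $(A,\ast)$: a bilinear operation with $(x\ast y)\ast z-x\ast(y\ast z)=(y\ast x)\ast z-y\ast(x\ast z)$. A noncommutative pre-Poisson algebra is $(A,\succ,\prec,\ast)$ such that $(A,\succ,\prec)$ is a dendriform algebra, $(A,\ast)$ is a pre-Lie algebra and, for all $x,y,z\in A$, $$(x\ast y-y\ast x)\succ z=x\ast(y\succ z)-y\succ(x\ast z),$$ $$x\prec(y\ast z-z\ast y)=y\ast(x\prec z)-(y\ast x)\prec z,$$ $$(x\succ y+x\prec y)\ast z=(x\ast z)\prec y+x\succ(y\ast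 z).$$ It is coherent if also $(x\succ y+x\prec y)\ast z=x\ast(y\succ z)+y\ast(z\prec x)$ for all $x,y,z$. A noncommutative Poisson algebra $(P,\cdot,\{-,-\})$ is a vector space with an associative (not necessarily commutative) product and a Lie bracket such that $\{x,y\cdot z\}=\{x,y\}\cdot z+y\cdot\{x,z\}$. It is coherent if $\{x,y\cdot z\}+\{y,z\cdot x\}+\{z,x\cdot y\}=0$ for all $x,y,z$. A representation of $P$ is $(V;\mathcal L,\mathcal R,\rho)$ with linear maps $\mathcal L,\mathcal R,\rho:P\to\mathfrak{gl}(V)$ such that for all $x,y$: $\mathcal L_{x\cdot y}=\mathcal L_x\mathcal L_y$, $\mathcal R_{x\cdot y}=\mathcal R_y\mathcal R_x$, $\mathcal L_x\mathcal R_y=\mathcal R_y\mathcal L_x$, $\rho(\{x,y\})=[\rho(x),\rho(y)]$, $\mathcal L_{\{x,y\}}=\rho(x)\mathcal L_y-\mathcal L_y\rho(x)$, $\mathcal R_{\{x,y\}}=\rho(x)\mathcal R_y-\mathcal R_y\rho(x)$, $\rho(x\cdot y)=\mathcal L_x\rho(y)+\mathcal R_y\rho(x)$. *)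

(* Defs.v *)
From HB Require Import structures.
From mathcomp Require Import all_boot all_order all_algebra.

Set Implicit Arguments.
Unset Strict Implicit.
Unset Printing Implicit Defensive.

Import GRing.Theory.
Local Open Scope ring_scope.

Definition bilinear_op (F : fieldType) (A : vectType F) (op : A -> A -> A) :
    Prop :=
  (forall y, linear (op^~ y)) /\ (forall x, linear (op x)).

Record is_dendriform (F : fieldType) (A : vectType F)
    (succ prec : A -> A -> A) : Prop := {
  dend_succ_bilinear : bilinear_op succ;
  dend_prec_bilinear : bilinear_op prec;
  dend_prec_prec : forall x y z,
    prec (prec x y) z = prec x (succ y z + prec y z);
  dend_succ_prec : forall x y z,
    prec (succ x y) z = succ x (prec y z);
  dend_succ_succ : forall x y z,
    succ x (succ y z) = succ (succ x y + prec x y) z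
}.

Record is_pre_Lie (F : fieldType) (A : vectType F)
    (ast : A -> A -> A) : Prop := {
  pre_Lie_bilinear : bilinear_op ast;
  pre_Lie_assoc_sym : forall x y z,
    ast (ast x y) z - ast x (ast y z) = ast (ast y x) z - ast y (ast x z)
}.

Record is_nc_pre_Poisson (F : fieldType) (A : vectType F)
    (succ prec ast : A -> A -> A) : Prop := {
  ncpp_dendriform : is_dendriform succ prec;
  ncpp_pre_Lie : is_pre_Lie ast;
  ncpp_comm_succ : forall x y z,
    succ (ast x y - ast y x) z = ast x (succ y z) - succ y (ast x z);
  ncpp_prec_comm : forall x y z,
    prec x (ast y z - ast z y) = ast y (prec x z) - prec (ast y x) z;
  ncpp_mul_ast : forall x y z,
    ast (succ x y + prec x y) z = prec (ast x z) y + succ x (ast y z)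
}.

Record is_coherent_nc_pre_Poisson (F : fieldType) (A : vectType F)
    (succ prec ast : A -> A -> A) : Prop := {
  coh_ncpp : is_nc_pre_Poisson succ prec ast;
  coh_ncpp_mul_ast : forall x y z,
    ast (succ x y + prec x y) z = ast x (succ y z) + ast y (prec z x)
}.

Record is_Lie_bracket (F : fieldType) (P : vectType F)
    (br : P -> P -> P) : Prop := {
  Lie_bilinear : bilinear_op br;
  Lie_alternating : forall x, br x x = 0;
  Lie_Jacobi : forall x y z,
    br x (br y z) + br y (br z x) + br z (br x y) = 0
}.

(* The associative product is not required to have a unit. *)
Record is_nc_Poisson (F : fieldType) (P : vectType F)
    (mul br : P -> P -> P) : Prop := {
  ncP_mul_bilinear : bilinear_op mul;
  ncP_mul_assoc : associative mul;
  ncP_Lie : is_Lie_bracket br;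
  ncP_Leibniz : forall x y z,
    br x (mul y z) = mul (br x y) z + mul y (br x z)
}.

Record is_coherent_nc_Poisson (F : fieldType) (P : vectType F)
    (mul br : P -> P -> P) : Prop := {
  coh_ncP : is_nc_Poisson mul br;
  coh_ncP_cyclic : forall x y z,
    br x (mul y z) + br y (mul z x) + br z (mul x y) = 0
}.

(* gl(V) is 'End(V), with bracket the commutator for composition. *)
Record is_representation (F : fieldType) (P : vectType F)
    (mul br : P -> P -> P) (V : vectType F)
    (L R rho : P -> 'End(V)) : Prop := {
  rep_L_linear : linear L;
  rep_R_linear : linear R;
  rep_rho_linear : linear rho;
  rep_L_mul : forall x y, L (mul x y) = (L x \o L y)%VF;
  rep_R_mul : forall x y, R (mul x y) = (R y \o R x)%VF;
  rep_LR : forall x y, (L x \o R y)%VF = (R y \o L x)%VF;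
  rep_rho_br : forall x y,
    rho (br x y) = (rho x \o rho y)%VF - (rho y \o rho x)%VF;
  rep_L_br : forall x y,
    L (br x y) = (rho x \o L y)%VF - (L y \o rho x)%VF;
  rep_R_br : forall x y,
    R (br x y) = (rho x \o R y)%VF - (R y \o rho x)%VF;
  rep_rho_mul : forall x y,
    rho (mul x y) = (L x \o rho y)%VF + (R y \o rho x)%VF
}.

Definition sub_adjacent_mul (F : fieldType) (A : vectType F)
    (succ prec : A -> A -> A) : A -> A -> A :=
  fun x y => succ x y + prec x y.

Definition sub_adjacent_bracket (F : fieldType) (A : vectType F)
    (ast : A -> A -> A) : A -> A -> A :=
  fun x y => ast x y - ast y x.

(* linfun packs a function as an element of 'End(A); it has the expected values
   only when the function is linear, hence left_multE and right_multE. *)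
Definition left_mult (F : fieldType) (A : vectType F)
    (op : A -> A -> A) (x : A) : 'End(A) := linfun (op x).

Definition right_mult (F : fieldType) (A : vectType F)
    (op : A -> A -> A) (x : A) : 'End(A) := linfun (op^~ x).

Lemma linfunE (F : fieldType) (A : vectType F) (f : A -> A) :
  linear f -> linfun f =1 f.
Proof.
move=> lf y.
pose g := GRing.isLinear.Build F A A *:%R f lf.
pose ff : {linear A -> A} := HB.pack f g.
exact: (lfunE ff y).
Qed.

Lemma left_multE (F : fieldType) (A : vectType F) (op : A -> A -> A) :
  bilinear_op op -> forall x y, left_mult op x y = op x y.
Proof. by move=> [_ lr] x y; rewrite linfunE. Qed.

Lemma right_multE (F : fieldType) (A : vectType F) (op : A -> A -> A) :
  bilinear_op op -> forall x y, right_mult op x y = op y x.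
Proof. by move=> [ll _] x y; rewrite (linfunE (ll x)). Qed.

(* Main.v *)
Require Import Defs.
From HB Require Import structures.
From mathcomp Require Import all_boot all_order all_algebra.
From mathcomp Require Import ring.

Set Implicit Arguments.
Unset Strict Implicit.
Unset Printing Implicit Defensive.

Import GRing.Theory VectorInternalTheory.
Local Open Scope ring_scope.

(** The axioms say that left [succ], right [prec] and left [ast] multiplications represent the sum
    product and the commutator of [ast] on [A] itself, so the representation claim is the axioms
    evaluated at a vector. The Poisson structure comes from adding such identities: the dendriform
    axioms add up to associativity, [pre_Lie_bracket_ast] yields Jacobi, and the mixed axioms yield
    Leibniz. *)

(* Identities between sums of vectors are checked coordinatewise, where they
   become ring identities in the base field. *)
Ltac vect_ring :=
  apply: v2r_inj; apply/rowP => i;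
  rewrite ?(linearD, linearN, linear0) ?mxE /=; ring.

Section Bilinear.

Variables (F : fieldType) (A : vectType F).
Implicit Types (f : A -> A) (op succ prec ast : A -> A -> A).

Lemma linear_fun_add f : linear f -> {morph f : u v / u + v}.
Proof. by move=> lf u v; have := lf 1 u v; rewrite !scale1r. Qed.

Lemma linear_fun_sub f : linear f -> {morph f : u v / u - v}.
Proof.
(* Reading [u - v] as [-1 *: v + u] makes it an instance of linearity. *)
by move=> lf u v; rewrite addrC -scaleN1r lf scaleN1r addrC.
Qed.

Lemma bilinear_addl op : bilinear_op op ->
  forall x y z, op (x + y) z = op x z + op y z.
Proof. by move=> [hl _] x y z; rewrite (linear_fun_add (hl z)). Qed.

Lemma bilinear_addr op : bilinear_op op ->
  forall x y z, op x (y + z) = op x y + op x z.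
Proof. by move=> [_ hr] x y z; rewrite (linear_fun_add (hr x)). Qed.

Lemma bilinear_subl op : bilinear_op op ->
  forall x y z, op (x - y) z = op x z - op y z.
Proof. by move=> [hl _] x y z; rewrite (linear_fun_sub (hl z)). Qed.

Lemma bilinear_subr op : bilinear_op op ->
  forall x y z, op x (y - z) = op x y - op x z.
Proof. by move=> [_ hr] x y z; rewrite (linear_fun_sub (hr x)). Qed.

Lemma sub_adjacent_mul_bilinear succ prec :
  bilinear_op succ -> bilinear_op prec ->
  bilinear_op (sub_adjacent_mul succ prec).
Proof.
move=> [sl sr] [pl pr]; split=> x a u v; rewrite /sub_adjacent_mul.
  by rewrite sl pl scalerDr addrACA.
by rewrite sr pr scalerDr addrACA.
Qed.

Lemma sub_adjacent_bracket_bilinear ast :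
  bilinear_op ast -> bilinear_op (sub_adjacent_bracket ast).
Proof.
move=> [hl hr]; split=> x a u v; rewrite /sub_adjacent_bracket.
  by rewrite hl hr scalerBr opprD addrACA.
by rewrite hl hr scalerBr opprD addrACA.
Qed.

Lemma left_mult_linear op : bilinear_op op -> linear (left_mult op).
Proof.
move=> hb a u v; apply/lfunP => z.
by rewrite add_lfunE scale_lfunE !left_multE //; case: hb => hl _; exact: hl.
Qed.

Lemma right_mult_linear op : bilinear_op op -> linear (right_mult op).
Proof.
move=> hb a u v; apply/lfunP => z.
by rewrite add_lfunE scale_lfunE !right_multE //; case: hb => _ hr; exact: hr.
Qed.

End Bilinear.

Section SubAdjacent.

Variables (F : fieldType) (A : vectType F) (succ prec ast : A -> A -> A).

(** Once expanded, each side has three terms, and each dendriform axiom matches one pair. *)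
Lemma dendriform_mul_assoc :
  is_dendriform succ prec -> associative (sub_adjacent_mul succ prec).
Proof.
case=> sb pb pp sp ss x y z; rewrite /sub_adjacent_mul.
by rewrite (bilinear_addr sb) (bilinear_addl pb) ss sp pp addrA.
Qed.

Lemma pre_Lie_bracket_ast : is_pre_Lie ast -> forall x y z,
  ast (sub_adjacent_bracket ast x y) z = ast x (ast y z) - ast y (ast x z).
Proof.
case=> ab asym x y z; rewrite /sub_adjacent_bracket (bilinear_subl ab).
(* Adding and subtracting [ast x (ast y z)] exposes the associator, whose symmetry in [x] and [y]
   applies. *)
by rewrite -[ast (ast x y) z](subrK (ast x (ast y z))) asym; vect_ring.
Qed.

Lemma pre_Lie_sub_adjacent :
  is_pre_Lie ast -> is_Lie_bracket (sub_adjacent_bracket ast).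
Proof.
move=> HL; have ab := pre_Lie_bilinear HL; split.
- exact: sub_adjacent_bracket_bilinear.
- by move=> x; rewrite /sub_adjacent_bracket subrr.
move=> x y z.
(* Only right-nested products remain, and these cancel in the cyclic sum. *)
have brE u v w : sub_adjacent_bracket ast u (sub_adjacent_bracket ast v w) =
    ast u (ast v w) - ast u (ast w v) - (ast v (ast w u) - ast w (ast v u)).
  by rewrite {1}/sub_adjacent_bracket pre_Lie_bracket_ast // (bilinear_subr ab).
by rewrite !brE; vect_ring.
Qed.

Lemma nc_pre_Poisson_sub_adjacent : is_nc_pre_Poisson succ prec ast ->
  is_nc_Poisson (sub_adjacent_mul succ prec) (sub_adjacent_bracket ast).
Proof.
case=> HD HL cs pc ma; have ab := pre_Lie_bilinear HL.
have sb := dend_succ_bilinear HD; have pb := dend_prec_bilinear HD.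
split.
- exact: sub_adjacent_mul_bilinear.
- exact: dendriform_mul_assoc.
- exact: pre_Lie_sub_adjacent.
move=> x y z; rewrite /sub_adjacent_bracket /sub_adjacent_mul.
(* The mixed axioms rewrite the product acting by [ast] and two of the four terms on the right; the
   other two expand by bilinearity, and all cancels. *)
rewrite ma cs pc (bilinear_addr ab) (bilinear_subl pb) (bilinear_subr sb).
by vect_ring.
Qed.

(** Coherence turns each [ast (y z) x] into terms of the form [ast a (succ b c)] and
    [ast a (prec b c)], cyclic shifts of those in [ast x (y z)]; the cyclic sum vanishes. *)
Lemma coherent_sub_adjacent : is_coherent_nc_pre_Poisson succ prec ast ->
  is_coherent_nc_Poisson (sub_adjacent_mul succ prec)
    (sub_adjacent_bracket ast).
Proof.
case=> HA cma; split; first exact: nc_pre_Poisson_sub_adjacent.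
have ab := pre_Lie_bilinear (ncpp_pre_Lie HA).
move=> x y z; rewrite /sub_adjacent_bracket /sub_adjacent_mul.
by rewrite !cma !(bilinear_addr ab); vect_ring.
Qed.

Lemma sub_adjacent_representation : is_nc_pre_Poisson succ prec ast ->
  is_representation (sub_adjacent_mul succ prec) (sub_adjacent_bracket ast)
    (left_mult succ) (right_mult prec) (left_mult ast).
Proof.
case=> HD HL cs pc ma; have ab := pre_Lie_bilinear HL.
case: HD => sb pb pp sp ss.
have sE := left_multE sb; have pE := right_multE pb; have aE := left_multE ab.
split; try exact: left_mult_linear; try exact: right_mult_linear;
  move=> x y; apply/lfunP => z;
  rewrite ?(add_lfunE, opp_lfunE, comp_lfunE) ?(sE, pE, aE).
(* Evaluated at [z], the seven remaining goals are the three dendriform axioms, the pre-Lie identity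
   and the three mixed axioms. *)
- by rewrite ss.
- by rewrite pp.
- by rewrite sp.
- exact: pre_Lie_bracket_ast.
- exact: cs.
- exact: pc.
- by rewrite ma addrC.
Qed.

End SubAdjacent.

Theorem theorem5p10 (F : closedFieldType) (charF0 : [pchar F] =i pred0)
    (A : vectType F) (succ prec ast : A -> A -> A)
    (HA : is_nc_pre_Poisson succ prec ast) :
  [/\ is_nc_Poisson (sub_adjacent_mul succ prec) (sub_adjacent_bracket ast),
      is_coherent_nc_pre_Poisson succ prec ast ->
        is_coherent_nc_Poisson (sub_adjacent_mul succ prec)
          (sub_adjacent_bracket ast)
    & is_representation (sub_adjacent_mul succ prec) (sub_adjacent_bracket ast)
        (left_mult succ) (right_mult prec) (left_mult ast)].
Proof.
split.
- exact: nc_pre_Poisson_sub_adjacent.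
- exact: coherent_sub_adjacent.
- exact: sub_adjacent_representation.
Qed.
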